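(* Let $A\in\mathbb{R}^{m\times n}$. Then the multifunction $S(\cdot,\cdot,A):\mathbb{R}\times\mathbb{R}^m\rightrightarrows\mathbb{R}^n$, $(\lambda,b)\mapsto S(\lambda,b,A)$, is Lipschitz continuous on its domain $\mathbb{R}_+\times\mathbb{R}^m$.
   Context: Notation: $\mathbb{R}_+=[0,\infty)$; $\|\cdot\|$ is the Euclidean norm, $\|\cdot\|_1$ the $\ell_1$-norm; $\operatorname{rge}A$ is the range of $A$ and $\operatorname{proj}_{\operatorname{rge}A}b$ is the Euclidean projection of $b$ onto $\operatorname{rge}A$; $\mathbb{B}$ is the closed unit Euclidean ball. Solution multifunction $S:\mathbb{R}\times\mathbb{R}^m\times\mathbb{R}^{m\times n}\rightrightarrows\mathbb{R}^n$: if $\lambda>0$, $S(\lambda,b,A)$ is the set of minimizers over $x\in\mathbb{R}^n$ of $\frac{1}{2\lambda}\|Ax-\operatorname{proj}_{\operatorname{rge}A}b\|^2+\|x\|_1$ (equivalently of the Lasso objective $\frac12\|Ax-b\|^2+\lambda\|x\|_1$); if $\lambda=0$, $S(0,b,A)$ is the set of minimizers of $\|x\|_1$ subject to $Ax=\operatorname{proj}_{\operatorname{rge}A}b$; if $\lambda<0$, $S(\lambda,b,A)=\emptyset$. The domain of a multifunction $G$ is $\operatorname{dom}G=\{x\mid G(x)\neq\emptyset\}$; thus $\operatorname{dom}S=\mathbb{R}_+\times\mathbb{R}^m\times\mathbb{R}^{m\times n}$. A multifunction $G$ is Lipschitz continuous on a set $X$ if $G(x)$ is nonempty and closed for every $x\in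 X$ and there is $\kappa\in\mathbb{R}_+$ with $G(x')\subset G(x)+\kappa\|x'-x\|\mathbb{B}$ for all $x,x'\in X$. *)

(* Defs.v *)
From HB Require Import structures.
From mathcomp Require Import all_boot all_order all_algebra.
From mathcomp Require Import all_classical all_reals all_analysis.
Set Implicit Arguments.
Unset Strict Implicit.
Unset Printing Implicit Defensive.
Import Order.TTheory GRing.Theory Num.Theory.
Import numFieldNormedType.Exports.
Local Open Scope classical_set_scope.
Local Open Scope ring_scope.

(* The library norm `|x| on matrices is the sup norm, hence the explicit
   Euclidean and l1 norms below. *)
Definition enorm (R : realType) (n : nat) (x : 'cV[R]_n) : R :=
  Num.sqrt (\sum_(i < n) x i 0 ^+ 2).

Definition l1norm (R : realType) (n : nat) (x : 'cV[R]_n) : R :=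
  \sum_(i < n) `|x i 0|.

Definition eball (R : realType) (n : nat) : set 'cV[R]_n :=
  [set u | enorm u <= 1].

(* Euclidean norm of (lambda, b) seen as a vector of R^(1 + m). *)
Definition pair_enorm (R : realType) (m : nat) (p : R * 'cV[R]_m) : R :=
  Num.sqrt (p.1 ^+ 2 + enorm p.2 ^+ 2).

Definition argmin (R : realType) (T : Type) (f : T -> R) (C : set T) : set T :=
  [set x | C x /\ forall y, C y -> f x <= f y].

(* The default value 0 of xget is never used: see proj_rgeP. *)
Definition proj_rge (R : realType) (m n : nat) (A : 'M[R]_(m, n))
    (b : 'cV[R]_m) : 'cV[R]_m :=
  xget 0 (argmin (fun p => enorm (b - p)) (range (fun x : 'cV[R]_n => A *m x))).

Definition lasso_sol (R : realType) (m n : nat) (lambda : R) (b : 'cV[R]_m)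
    (A : 'M[R]_(m, n)) : set 'cV[R]_n :=
  if 0 < lambda then
    argmin (fun x => (2 * lambda)^-1 * enorm (A *m x - proj_rge A b) ^+ 2
                     + l1norm x) setT
  else if lambda == 0 then
    argmin (@l1norm R n) [set x | A *m x = proj_rge A b]
  else set0.

Definition mf_dom (U V : Type) (G : U -> set V) : set U :=
  [set x | G x !=set0].

(* normU is the norm of the source space. Closedness refers to the library
   topology of 'cV[R]_n, which is the Euclidean one since all norms on R^n
   are equivalent. *)
Definition mf_lipschitz_on (R : realType) (U : zmodType) (normU : U -> R)
    (n : nat) (G : U -> set 'cV[R]_n) (X : set U) : Prop :=
  (forall x, X x -> G x !=set0 /\ closed (G x)) /\
  exists2 kappa : R, 0 <= kappa &
    forall x x', X x -> X x' ->
      G x' `<=` [set y + (kappa * normU (x' - x)) *: u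
                | y in G x & u in @eball R n].

Lemma enorm_ge0 (R : realType) k (x : 'cV[R]_k) : 0 <= enorm x.
Proof. exact: sqrtr_ge0. Qed.

Lemma sqr_enorm (R : realType) k (x : 'cV[R]_k) :
  enorm x ^+ 2 = (x^T *m x) 0 0.
Proof.
rewrite /enorm sqr_sqrtr; last by apply: sumr_ge0 => i _; exact: sqr_ge0.
by rewrite mxE; apply: eq_bigr => i _; rewrite mxE expr2.
Qed.

Lemma sqr_enorm_le0 (R : realType) k (x : 'cV[R]_k) :
  enorm x ^+ 2 <= 0 -> x = 0.
Proof.
rewrite /enorm sqr_sqrtr; last by apply: sumr_ge0 => i _; exact: sqr_ge0.
move=> le0; apply/colP => i; rewrite mxE; apply/eqP; rewrite -sqrf_eq0.
have : \sum_(i < k) x i 0 ^+ 2 == 0.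
  by rewrite eq_le le0 /=; apply: sumr_ge0 => j _; exact: sqr_ge0.
rewrite psumr_eq0; last by move=> j _; exact: sqr_ge0.
by move/allP/(_ i (mem_index_enum i)).
Qed.

Lemma normal_equation (R : realType) m n (A : 'M[R]_(m, n)) (b : 'cV[R]_m) :
  exists x : 'cV[R]_n, A^T *m (b - A *m x) = 0.
Proof.
have : (b^T *m A <= A^T *m A)%MS.
  rewrite submxE; set C := cokermx _.
  have AC0 : A *m C = 0.
    apply/matrixP => i j.
    have /sqr_enorm_le0 /colP/(_ i) : enorm (col j (A *m C)) ^+ 2 <= 0.
      have -> : col j (A *m C) = A *m col j C by rewrite !colE -mulmxA.
      rewrite sqr_enorm trmx_mul -!mulmxA [A^T *m _]mulmxA.
      rewrite [col j C]colE [_ *m (C *m _)]mulmxA mulmx_coker.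
      by rewrite mul0mx mulmx0 mxE lexx.
    by rewrite !mxE.
  by rewrite -mulmxA AC0 mulmx0.
move=> /submxP[D bAE]; exists D^T.
rewrite mulmxBr -[X in _ = X](subrr (A^T *m b)); congr (_ - _).
by apply: trmx_inj; rewrite !trmx_mul !trmxK bAE mulmxA.
Qed.

Lemma proj_rgeP (R : realType) m n (A : 'M[R]_(m, n)) (b p : 'cV[R]_m) :
  argmin (fun p => enorm (b - p)) (range (fun x : 'cV[R]_n => A *m x)) p
  <-> p = proj_rge A b.
Proof.
have [x0 x0P] := normal_equation A b.
have pyth z : enorm (b - A *m z) ^+ 2 =
    enorm (b - A *m x0) ^+ 2 + enorm (A *m (x0 - z)) ^+ 2.
  have -> : b - A *m z = (b - A *m x0) + A *m (x0 - z).
    by rewrite mulmxBr addrA subrK.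
  have o1 : (A *m (x0 - z))^T *m (b - A *m x0) = 0.
    by rewrite trmx_mul -mulmxA x0P mulmx0.
  have o2 : (b - A *m x0)^T *m (A *m (x0 - z)) = 0.
    by apply: trmx_inj; rewrite trmx_mul trmxK o1 !trmx0.
  move: o1 o2; move: (b - _) (A *m (_ - z)) => u v o1 o2.
  rewrite !sqr_enorm (raddfD (@trmx R m 1)) /= mulmxDl !mulmxDr o1 o2.
  by rewrite addr0 add0r mxE.
have min0 : argmin (fun p => enorm (b - p))
    (range (fun x : 'cV[R]_n => A *m x)) (A *m x0).
  split; first by exists x0.
  move=> _ [z _ <-]; rewrite -(@ler_pXn2r _ 2) ?nnegrE ?enorm_ge0//.
  by rewrite (pyth z) lerDl sqr_ge0.
have uniq q : argmin (fun p => enorm (b - p))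
    (range (fun x : 'cV[R]_n => A *m x)) q -> q = A *m x0.
  move=> [[z _ <-] minz]; have := minz _ (proj1 min0).
  rewrite -(@ler_pXn2r _ 2) ?nnegrE ?enorm_ge0// (pyth z) gerDl.
  by move/sqr_enorm_le0/eqP; rewrite mulmxBr subr_eq0 => /eqP <-.
have -> : proj_rge A b = A *m x0 by apply: uniq; exact: xgetI min0.
by split=> [/uniq|->].
Qed.

(* Main.v *)
Require Import Defs.
From HB Require Import structures.
From mathcomp Require Import all_boot all_order all_algebra.
From mathcomp Require Import all_classical all_reals all_analysis.
From mathcomp Require Import ring lra.
Set Implicit Arguments.
Unset Strict Implicit.
Unset Printing Implicit Defensive.
Import Order.TTheory GRing.Theory Num.Theory.
Import numFieldNormedType.Exports.
Local Open Scope classical_set_scope.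
Local Open Scope ring_scope.

(** Write N x for the l1 norm of x.  Two facts reduce the theorem to linear
inequalities.

A solution set is a slice of one fibre of A.  If x solves the problem with
data (lambda, b), then x has minimal l1 norm among the points with the same
image under A, since moving inside the fibre does not change the quadratic
term; conversely every y with A y = A x and N y <= N x is again a solution
([lasso_sol_fibre_min], [lasso_sol_fibre]).  So it suffices to control A x and
N x, and then to correct a solution x' for other data into the polyhedron
{y | A y = A x, N y <= N x}.

The fitted value A x is a Lipschitz function of (lambda, b).  A solution
satisfies the variational inequality
  <b - A x, A (y - x)> <= lambda (N y - N x)   for all y,
also when lambda = 0 ([lasso_sol_variational]).  For two solutions x and y, with
D = A (x - y), adding the two inequalities gives
  |D|^2 <= <b - b', D> + (lambda - lambda') (N y - N x).
On points of minimal norm in their fibres, N is a Lipschitz function of the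
image under A, because a pseudo-inverse of A lifts the displacement of the
image ([fibre_min_lipschitz]).  Hence the last factor is at most L |D|, and |D|
is bounded by a multiple of the distance of the data ([lasso_fit_lipschitz]).

The correction step is an error bound of Hoffman: a point that violates a
feasible system of linear inequalities by at most e lies within kappa e of a
solution, with kappa depending on the coefficients but not on the right-hand
sides ([hoffman]).  The bound N y <= c is such a system, with one inequality
per sign vector, so the constant is the same for all fibres and all levels
([l1_fibre_error_bound]).

Solutions exist because the objectives are continuous and dominate N, whose
sublevel sets are bounded. *)

(** * Hoffman's error bound by Fourier-Motzkin elimination *)

Lemma sum_mul_lipschitz (R : realFieldType) n (c x y : 'I_n -> R) (e : R) :
  (forall j, `|x j - y j| <= e) ->
  `|\sum_j c j * x j - \sum_j c j * y j| <= (\sum_j `|c j|) * e.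
Proof.
move=> xye; rewrite -sumrB (le_trans (ler_norm_sum _ _ _))// mulr_suml.
by apply: ler_sum => j _; rewrite -mulrBr normrM ler_wpM2l.
Qed.

(** One Fourier-Motzkin step for the rows a i * t + v i: a row free of t is kept,
and a pair of rows with coefficients of opposite signs is combined so that t
cancels.  Every index that does not correspond to a new row yields the trivial
row 0, so that the new system is indexed by a finite type built from I alone. *)
Definition elim_row (R : realFieldType) (I : finType) (a v : I -> R)
    (s : I + I * I) : R :=
  match s with
  | inl i => if a i == 0 then v i else 0
  | inr (i, k) => if (0 < a i) && (a k < 0) then a i * v k - a k * v i else 0
  end.

Lemma elim_row_residual (R : realFieldType) (I : finType) n (a d : I -> R)
    (C : I -> 'I_n -> R) (x : 'I_n -> R) s :
  elim_row a (fun i => d i - \sum_j C i j * x j) s =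
  elim_row a d s - \sum_j elim_row a (C^~ j) s * x j.
Proof.
case: s => [i|[i k]] /=; case: ifP => _ //.
- by rewrite big1 ?subr0// => j _; rewrite mul0r.
- have -> : \sum_j (a i * C k j - a k * C i j) * x j =
      a i * (\sum_j C k j * x j) - a k * (\sum_j C i j * x j).
    by rewrite !mulr_sumr -sumrB; apply: eq_bigr => j _; ring.
  by ring.
- by rewrite big1 ?subr0// => j _; rewrite mul0r.
Qed.

(** The eliminated rows are nonnegative combinations of the original ones, so
violations at most e become violations at most M * e, where M bounds the total
weight of every combination. *)
Lemma elim_row_sound (R : realFieldType) (I : finType) (a r : I -> R) (t e : R) s :
  0 <= e -> (forall i, a i * t <= r i + e) ->
  0 <= elim_row a r s + (1 + (\sum_i `|a i|) *+ 2) * e.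
Proof.
move=> e0 atr; set M := 1 + _.
have M1 : 1 <= M by rewrite lerDl mulrn_wge0// sumr_ge0.
have Me0 : e <= M * e by rewrite ler_peMl.
case: s => [i|[i k]] /=; case: ifP => [|_]; try lra.
- by move=> /eqP ai0; have := atr i; rewrite ai0 mul0r; lra.
- move=> /andP[ai ak]; have := ler_wpM2l (ltW ai) (atr k).
  have ak' : 0 <= - a k by lra.
  have := ler_wpM2l ak' (atr i).
  have le_sum l : `|a l| <= \sum_i `|a i| by rewrite (bigD1 l)//= lerDl sumr_ge0.
  have aM : a i - a k <= M.
    rewrite /M mulr2n; have := le_sum i; have := le_sum k.
    by rewrite (gtr0_norm ai) (ltr0_norm ak); lra.
  by have := ler_wpM2r e0 aM; lra.
Qed.

(** Converse of the elimination with control of the lifted coordinate.  The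
pair rows say that each lower bound on t is below each upper bound.  The
hypothesis on t' puts the interval [t' - delta, t' + delta] in a similar
position: its lower end is below each upper bound, and its upper end is above
each lower bound.  So the lower bounds together with t' - delta have a maximum
that is admissible and within delta of t'. *)
Lemma elim_row_complete (R : realFieldType) (I : finType) (a r : I -> R)
    (t' delta : R) :
  0 <= delta -> (forall s, 0 <= elim_row a r s) ->
  (forall i, a i != 0 -> a i * t' <= r i + delta * `|a i|) ->
  exists2 t, `|t - t'| <= delta & forall i, a i * t <= r i.
Proof.
move=> delta0 er0 at'.
pose t := \big[Num.max/t' - delta]_(k | a k < 0) (r k / a k).
have t_le (z : R) : t' - delta <= z ->
    (forall k, a k < 0 -> r k / a k <= z) -> t <= z.
  by move=> *; exact: bigmax_le.
exists t => [|i].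
  rewrite ler_distl bigmax_ge_id/=; apply: t_le; first lra.
  move=> k ak; rewrite ler_ndivrMr//.
  by have := at' k (ltr0_neq0 ak); rewrite (ltr0_norm ak); lra.
have [ai|ai|ai] := ltgtP (a i) 0.
- by rewrite mulrC -ler_ndivrMr//; exact: (le_bigmax_cond _ (fun k => r k / a k)).
- rewrite mulrC -ler_pdivlMr//; apply: t_le.
    rewrite ler_pdivlMr//; have := at' i; rewrite gt_eqF// (gtr0_norm ai).
    by move=> /(_ isT); lra.
  move=> k ak; have := er0 (inr (i, k)) => /=; rewrite ai ak/=.
  by rewrite ler_ndivrMr// mulrAC ler_pdivrMr//; lra.
- by have := er0 (inl i); rewrite /= ai eqxx mul0r.
Qed.

(** Hoffman's error bound, by induction on the number of variables: eliminate
the first variable, correct the remaining ones in the smaller system, and lift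
the result back with the first coordinate as close as possible to its original
value.  The feasibility of the system enters as the existence of x0, because
the eliminated system inherits it. *)
Lemma hoffman (R : realFieldType) n (I : finType) (B : I -> 'I_n -> R) :
  exists2 kappa : R, 0 <= kappa &
    forall (d : I -> R) (x0 x' : 'I_n -> R) (e : R), 0 <= e ->
      (forall i, \sum_j B i j * x0 j <= d i) ->
      (forall i, \sum_j B i j * x' j <= d i + e) ->
      exists2 x : 'I_n -> R, forall i, \sum_j B i j * x j <= d i
        & forall j, `|x j - x' j| <= kappa * e.
Proof.
elim: n I B => [|n IHn] I B.
  by exists 0 => // d x0 x' e _ x0P _; exists x0 => // -[].
pose a i := B i ord0; pose C i j := B i (lift ord0 j).
have BE i (x : 'I_n.+1 -> R) :
    \sum_j B i j * x j = a i * x ord0 + \sum_j C i j * x (lift ord0 j).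
  by rewrite big_ord_recl.
have [kh kh0 khP] := IHn _ (fun s j => elim_row a (C^~ j) s).
pose M := 1 + (\sum_i `|a i|) *+ 2.
have M0 : 0 <= M by rewrite addr_ge0// mulrn_wge0// sumr_ge0.
(* g i is the displacement of the first coordinate, per unit of e, forced by
   row i once the other coordinates have moved by at most kh * M * e *)
pose g i := (1 + (\sum_j `|C i j|) * (kh * M)) / `|a i|.
have g0 i : 0 <= g i.
  by rewrite divr_ge0// addr_ge0// mulr_ge0 ?sumr_ge0// mulr_ge0.
pose K := \sum_i g i.
have gK i : g i <= K by rewrite /K (bigD1 i)//= lerDl sumr_ge0.
have K0 : 0 <= K by rewrite sumr_ge0.
exists (kh * M + K); first by rewrite addr_ge0// mulr_ge0.
move=> d x0 x' e e0 x0P x'P.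
pose tl (x : 'I_n.+1 -> R) j := x (lift ord0 j).
have res_sound (x : 'I_n.+1 -> R) e1 s : 0 <= e1 ->
    (forall i, \sum_j B i j * x j <= d i + e1) ->
    \sum_j elim_row a (C^~ j) s * tl x j <= elim_row a d s + M * e1.
  move=> e10 xP; have := elim_row_residual a d C (tl x) s.
  have := @elim_row_sound _ _ a (fun i => d i - \sum_j C i j * tl x j)
    (x ord0) e1 s e10; rewrite -/M => snd.
  suff /snd : forall i, a i * x ord0 <= d i - \sum_j C i j * tl x j + e1 by lra.
  by move=> i; have := xP i; rewrite BE /tl; lra.
have [|s|s|xh xhP xhd] :=
    khP (elim_row a d) (tl x0) (tl x') (M * e); first exact: mulr_ge0.
- have := res_sound x0 0 s (lexx 0); rewrite mulr0 addr0; apply => i.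
  by rewrite addr0.
- exact: res_sound.
have [||i ai|t tx' tP] := @elim_row_complete _ _ a
    (fun i => d i - \sum_j C i j * xh j) (x' ord0) (K * e).
- exact: mulr_ge0.
- by move=> s; rewrite elim_row_residual subr_ge0.
- have := sum_mul_lipschitz (C i) xhd; rewrite ler_norml => /andP[_].
  have := x'P i; rewrite BE -/(tl x').
  have : g i * `|a i| * e <= K * `|a i| * e.
    by rewrite ler_wpM2r// ler_wpM2r.
  by rewrite divfK ?normr_eq0// /tl; lra.
exists (fun j => if unlift ord0 j is Some k then xh k else t) => [i|j].
  rewrite BE unlift_none (eq_bigr (fun j => C i j * xh j)) => [|j _].
    by have := tP i; lra.
  by rewrite liftK.
have khM0 : 0 <= kh * M * e by rewrite mulr_ge0// mulr_ge0.
have Ke0 : 0 <= K * e by exact: mulr_ge0.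
case: unliftP => [k|] ->; last by rewrite mulrDl; lra.
by rewrite (le_trans (xhd k))// mulrA mulrDl lerDl.
Qed.

(** * Euclidean and l1 norms *)

Definition dotmx (R : realType) n (u v : 'cV[R]_n) : R := \sum_i u i 0 * v i 0.

Lemma dotmxDl (R : realType) n (u v w : 'cV[R]_n) :
  dotmx (u + v) w = dotmx u w + dotmx v w.
Proof. by rewrite -big_split; apply: eq_bigr => i _; rewrite !mxE mulrDl. Qed.

Lemma dotmxNl (R : realType) n (u v : 'cV[R]_n) : dotmx (- u) v = - dotmx u v.
Proof. by rewrite -sumrN; apply: eq_bigr => i _; rewrite !mxE mulNr. Qed.

Lemma dotmxNr (R : realType) n (u v : 'cV[R]_n) : dotmx u (- v) = - dotmx u v.
Proof. by rewrite -sumrN; apply: eq_bigr => i _; rewrite !mxE mulrN. Qed.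

Lemma sqr_enorm_sum (R : realType) n (u : 'cV[R]_n) :
  enorm u ^+ 2 = \sum_i u i 0 ^+ 2.
Proof. by rewrite sqr_sqrtr// sumr_ge0// => i _; exact: sqr_ge0. Qed.

Lemma dotmxx (R : realType) n (u : 'cV[R]_n) : dotmx u u = enorm u ^+ 2.
Proof. by rewrite sqr_enorm_sum; apply: eq_bigr => i _; rewrite expr2. Qed.

Lemma sqr_enormDZ (R : realType) n (u v : 'cV[R]_n) t :
  enorm (u + t *: v) ^+ 2 =
  enorm u ^+ 2 + t * (2 * dotmx u v) + t ^+ 2 * enorm v ^+ 2.
Proof.
rewrite !sqr_enorm_sum /dotmx !mulr_sumr -!big_split.
by apply: eq_bigr => i _; rewrite !mxE /=; ring.
Qed.

(** This replaces the Cauchy-Schwarz inequality: the constants of the estimates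
below are not meant to be sharp. *)
Lemma dotmx_young (R : realType) n (u v : 'cV[R]_n) :
  2 * dotmx u v <= enorm u ^+ 2 + enorm v ^+ 2.
Proof. by have := sqr_ge0 (enorm (u + -1 *: v)); rewrite sqr_enormDZ; lra. Qed.

Lemma coord_le_enorm (R : realType) n (u : 'cV[R]_n) i : `|u i 0| <= enorm u.
Proof.
rewrite -(@ler_pXn2r _ 2)// ?nnegrE ?enorm_ge0// sqr_enorm_sum.
rewrite real_normK ?num_real//.
by rewrite (bigD1 i)//= lerDl sumr_ge0// => j _; exact: sqr_ge0.
Qed.

Lemma l1norm_ge0 (R : realType) n (u : 'cV[R]_n) : 0 <= l1norm u.
Proof. exact: sumr_ge0. Qed.

Lemma enorm_le_l1norm (R : realType) n (u : 'cV[R]_n) : enorm u <= l1norm u.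
Proof.
rewrite -(@ler_pXn2r _ 2)// ?nnegrE ?enorm_ge0 ?l1norm_ge0// sqr_enorm_sum.
rewrite expr2 {1}/l1norm mulr_suml; apply: ler_sum => i _.
rewrite -real_normK ?num_real// expr2 ler_wpM2l//.
by rewrite /l1norm (bigD1 i)//= lerDl sumr_ge0.
Qed.

Lemma l1normD (R : realType) n (u v : 'cV[R]_n) :
  l1norm (u + v) <= l1norm u + l1norm v.
Proof.
by rewrite -big_split; apply: ler_sum => i _; rewrite mxE ler_normD.
Qed.

Lemma l1normZ (R : realType) n (t : R) (u : 'cV[R]_n) :
  l1norm (t *: u) = `|t| * l1norm u.
Proof. by rewrite mulr_sumr; apply: eq_bigr => i _; rewrite mxE normrM. Qed.

Lemma l1norm_segment (R : realType) n (x y : 'cV[R]_n) t : 0 <= t <= 1 ->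
  l1norm (x + t *: (y - x)) <= l1norm x + t * (l1norm y - l1norm x).
Proof.
move=> /andP[t0 t1]; have -> : x + t *: (y - x) = (1 - t) *: x + t *: y.
  by apply/colP => i; rewrite !mxE; ring.
rewrite (le_trans (l1normD _ _))// !l1normZ !ger0_norm ?subr_ge0//; lra.
Qed.

Lemma l1norm_mulmx_le (R : realType) m n (B : 'M[R]_(n, m)) (z : 'cV[R]_m) :
  l1norm (B *m z) <= (\sum_i \sum_j `|B i j|) * enorm z.
Proof.
rewrite mulr_suml; apply: ler_sum => i _; rewrite mxE mulr_suml.
rewrite (le_trans (ler_norm_sum _ _ _))//; apply: ler_sum => j _.
by rewrite normrM ler_wpM2l// coord_le_enorm.
Qed.

(** * Existence and closedness of the solution sets *)

Lemma trmx_continuous (R : realType) m n :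
  continuous (@trmx R m n : 'M[R]_(m, n) -> 'M[R]_(n, m)).
Proof.
move=> M s /= /(nbhs_ballP M^T) [e e0 es].
apply/nbhs_ballP; exists e => //= N [_ MN]; apply: es; split=> // i j.
by rewrite !mxE.
Qed.

Lemma continuous_sum (R : realType) (T : topologicalType) (I : Type)
    (r : seq I) (F : I -> T -> R) :
  (forall i, continuous (F i)) -> continuous (fun x => \sum_(i <- r) F i x).
Proof.
by move=> cF; apply: continuous_big => [|i _]; [exact: add_continuous|exact: cF].
Qed.

Lemma colvec_coord_continuous (R : realType) n (i : 'I_n) :
  continuous (fun x : 'cV[R]_n => x i 0).
Proof. exact: coord_continuous. Qed.

Lemma l1norm_continuous (R : realType) n : continuous (@l1norm R n).
Proof.
apply: continuous_sum => i x.
apply: (@cvg_comp _ _ _ _ (@Num.norm _ R)); last exact: norm_continuous.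
exact: colvec_coord_continuous.
Qed.

Lemma mulmx_coord_continuous (R : realType) m n (A : 'M[R]_(m, n)) i :
  continuous (fun x : 'cV[R]_n => (A *m x) i 0).
Proof.
have -> : (fun x : 'cV[R]_n => (A *m x) i 0) =
    (fun x => \sum_j A i j * x j 0) by apply/funext => x; rewrite mxE.
apply: continuous_sum => j x.
apply: (@cvg_comp _ _ _ _ (fun t : R => A i j * t)); last exact: mulrl_continuous.
exact: colvec_coord_continuous.
Qed.

Lemma residual_continuous (R : realType) m n (A : 'M[R]_(m, n)) p :
  continuous (fun x : 'cV[R]_n => enorm (A *m x - p) ^+ 2).
Proof.
have -> : (fun x : 'cV[R]_n => enorm (A *m x - p) ^+ 2) =
    (fun x => \sum_i ((A *m x) i 0 - p i 0) ^+ 2).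
  apply/funext => x; rewrite /enorm sqr_sqrtr; last first.
    by apply: sumr_ge0 => i _; exact: sqr_ge0.
  by apply: eq_bigr => i _; rewrite !mxE.
apply: continuous_sum => i x.
apply: (@cvg_comp _ _ _ _ (fun t : R => (t - p i 0) ^+ 2)).
  exact: mulmx_coord_continuous.
apply: (@cvg_comp _ _ _ _ (fun t : R => t ^+ 2)); last exact: exprn_continuous.
by apply: cvgB; [exact: cvg_id|exact: cvg_cst].
Qed.

Lemma lasso_objective_continuous (R : realType) m n (A : 'M[R]_(m, n)) p c :
  continuous (fun x : 'cV[R]_n => c * enorm (A *m x - p) ^+ 2 + l1norm x).
Proof.
move=> x.
apply: (@continuousD R R^o _ (fun x => c * enorm (A *m x - p) ^+ 2)
  (@l1norm R n)); last exact: l1norm_continuous.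
apply: (@cvg_comp _ _ _ _ (fun t : R => c * t)); last exact: mulrl_continuous.
exact: residual_continuous.
Qed.

Lemma closed_mulmx_eq (R : realType) m n (A : 'M[R]_(m, n)) p :
  closed [set x : 'cV[R]_n | A *m x = p].
Proof.
have -> : [set x : 'cV[R]_n | A *m x = p] =
    \bigcap_(i in [set: 'I_m]) [set x | (A *m x) i 0 = p i 0].
  apply/seteqP; split=> [x /= xp i _ /=|x xp]; first by rewrite xp.
  by apply/colP => i; exact: xp.
apply: closed_bigI => i _.
apply: (preimage_closed (D := [set y | y = p i 0])) => [x _|].
  exact: mulmx_coord_continuous.
exact: closed_eq.
Qed.

Lemma argmin_closed (R : realType) (T : topologicalType) (f : T -> R) (C : set T) :
  continuous f -> closed C -> closed (argmin f C).
Proof.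
move=> cf cC.
have -> : argmin f C = C `&` \bigcap_(y in C) (f @^-1` [set z | z <= f y]).
  by [].
apply: closedI => //; apply: closed_bigI => y _.
by apply: preimage_closed => [x _|]; [exact: cf|exact: closed_le].
Qed.

(** The lower bound by the l1 norm makes f coercive: the points where f does not
exceed a given value lie in a cube. *)
Lemma argmin_nonempty (R : realType) n (f : 'cV[R]_n -> R) (C : set 'cV[R]_n) :
  continuous f -> closed C -> C !=set0 -> (forall x, l1norm x <= f x) ->
  argmin f C !=set0.
Proof.
move=> cf cC [x0 Cx0] l1f.
(* [rV_compact] speaks of row vectors, hence the detour by transposition *)
pose box : set 'rV[R]_n := [set v | forall i, `[- f x0, f x0]%classic (v ord0 i)].
have cbox : compact (@trmx R 1 n @` box).
  apply: continuous_compact.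
    apply: continuous_subspaceT.
    exact: (@trmx_continuous R 1 n).
  exact: (rV_compact (fun=> @segment_compact _ _ _)).
pose L := C `&` f @^-1` [set z | z <= f x0].
have cL : compact L.
  apply: subclosed_compact cbox _.
    apply: closedI => //; apply: preimage_closed => [x _|]; first exact: cf.
    exact: closed_le.
  move=> x [_ /= fx]; exists x^T; last by rewrite trmxK.
  move=> i /=; rewrite in_itv/= -ler_norml mxE (le_trans _ fx)//.
  by rewrite (le_trans _ (l1f x))// /l1norm (bigD1 i)//= lerDl sumr_ge0.
have [|c] := compact_EVT_min _ cL (continuous_subspaceT cf).
  by exists x0; split=> //=; exact: lexx.
rewrite inE => -[Cc /= cx0] cmin; exists c; split=> // y Cy.
have [fy|/ltW fy] := leP (f y) (f x0); last exact: le_trans fy.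
by apply: cmin; rewrite inE.
Qed.

Lemma lasso_sol_nonempty (R : realType) m n (A : 'M[R]_(m, n)) lambda b :
  0 <= lambda -> lasso_sol lambda b A !=set0.
Proof.
rewrite le_eqVlt /lasso_sol => /predU1P[<-|lambda0].
  rewrite ltxx eqxx; apply: argmin_nonempty => //.
  - exact: l1norm_continuous.
  - exact: closed_mulmx_eq.
  - by have [[z _ zp] _] := (proj_rgeP A b _).2 erefl; exists z.
rewrite lambda0; apply: argmin_nonempty.
- exact: lasso_objective_continuous.
- exact: closedT.
- by exists 0.
- by move=> x; rewrite lerDr mulr_ge0 ?sqr_ge0// invr_ge0 mulr_ge0// ltW.
Qed.

Lemma lasso_sol_closed (R : realType) m n (A : 'M[R]_(m, n)) lambda b :
  closed (lasso_sol lambda b A).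
Proof.
rewrite /lasso_sol; case: ifP => _; last case: ifP => _; last exact: closed0.
- apply: argmin_closed; last exact: closedT.
  exact: lasso_objective_continuous.
- apply: argmin_closed; [exact: l1norm_continuous|exact: closed_mulmx_eq].
Qed.

(** * Fibres of A, optimality and the fitted value *)

(** First-order condition at a minimum in one variable: a quadratic polynomial
that vanishes at 0 and is nonnegative on (0, 1] has nonnegative slope at 0. *)
Lemma slope_ge0 (R : realFieldType) (a c : R) :
  (forall t, 0 < t <= 1 -> 0 <= t * a + t ^+ 2 * c) -> 0 <= a.
Proof.
move=> tac; rewrite leNgt; apply/negP => a0.
(* for a < 0, this t satisfies t * |c| < - a, so the polynomial is negative *)
pose t := - a / (`|c| - a).
have ca0 : 0 < `|c| - a by have := normr_ge0 c; lra.
have t0 : 0 < t by rewrite divr_gt0//; lra.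
have tE : t * (`|c| - a) = - a by rewrite divfK// gt_eqF.
have t1 : t <= 1 by rewrite ler_pdivrMr//; have := normr_ge0 c; lra.
have := tac t; rewrite t0 t1 => /(_ isT).
rewrite expr2 -mulrA -mulrDr pmulr_rge0//.
have := ler_wpM2l (ltW t0) (ler_norm c).
have : t * a < 0 by rewrite pmulr_rlt0.
by lra.
Qed.

Lemma proj_rge_normal (R : realType) m n (A : 'M[R]_(m, n)) b (z : 'cV[R]_n) :
  dotmx (b - proj_rge A b) (A *m z) = 0.
Proof.
have [[w _ wp] pmin] := (proj_rgeP A b _).2 erefl.
have le0 v : 0 <= - (2 * dotmx (b - proj_rge A b) (A *m v)).
  apply: (@slope_ge0 _ _ (enorm (A *m v) ^+ 2)) => t _.
  have := pmin (proj_rge A b + t *: (A *m v)).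
  have pR : range [eta mulmx A] (proj_rge A b + t *: (A *m v)).
    by exists (w + t *: v) => //; rewrite mulmxDr wp scalemxAr.
  move=> /(_ pR); rewrite /= -(@ler_pXn2r _ 2)// ?nnegrE ?enorm_ge0//.
  have -> : b - (proj_rge A b + t *: (A *m v)) =
      b - proj_rge A b + (- t) *: (A *m v).
    by rewrite opprD addrA scaleNr.
  by rewrite /= sqr_enormDZ; lra.
have := le0 z; have := le0 (- z); rewrite mulmxN dotmxNr; lra.
Qed.

(** Within a fibre of A the quadratic term is constant, and so is the constraint
of the case lambda = 0. *)
Lemma lasso_sol_fibre_min (R : realType) m n (A : 'M[R]_(m, n)) lambda b
    (x y : 'cV[R]_n) :
  lasso_sol lambda b A x -> A *m y = A *m x -> l1norm x <= l1norm y.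
Proof.
rewrite /lasso_sol => + Ayx; case: ifP => _; last case: ifP => _ //.
- by move=> [_ /(_ y I)]; rewrite Ayx lerD2l.
- by move=> [/= Ax /(_ y)]; apply; rewrite /= Ayx.
Qed.

Lemma lasso_sol_fibre (R : realType) m n (A : 'M[R]_(m, n)) lambda b
    (x y : 'cV[R]_n) :
  lasso_sol lambda b A x -> A *m y = A *m x -> l1norm y <= l1norm x ->
  lasso_sol lambda b A y.
Proof.
rewrite /lasso_sol => + Ayx yx; case: ifP => _; last case: ifP => _ //.
- by move=> [_ xmin]; split=> // z /xmin; apply: le_trans; rewrite Ayx lerD2l.
- by move=> [/= Ax xmin]; split=> [|z /xmin]; [rewrite /= Ayx|exact: le_trans].
Qed.

(** First-order optimality of x, on the segment from x to y, where the
subgradient of the l1 norm is replaced by its convexity.  The projection can be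
replaced by b because b minus its projection is orthogonal to the range of A.
For lambda = 0 the left-hand side vanishes, since A x is the projection. *)
Lemma lasso_sol_variational (R : realType) m n (A : 'M[R]_(m, n)) lambda b
    (x y : 'cV[R]_n) :
  lasso_sol lambda b A x ->
  dotmx (b - A *m x) (A *m (y - x)) <= lambda * (l1norm y - l1norm x).
Proof.
have -> : b - A *m x = (b - proj_rge A b) + (proj_rge A b - A *m x).
  by rewrite addrA subrK.
rewrite dotmxDl proj_rge_normal add0r; set p := proj_rge A b.
rewrite /lasso_sol; case: ifP => [lambda0|_]; last first.
  case: ifP => // /eqP -> [/= -> _]; rewrite subrr mul0r /dotmx big1// => i _.
  by rewrite mxE mul0r.
move=> [_ xmin]; rewrite -subr_ge0.
set N := l1norm y - _; set D := A *m (y - x).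
apply: (@slope_ge0 _ _ (enorm D ^+ 2 / 2)) => t /andP[t0 t1].
have := xmin (x + t *: (y - x)) I; rewrite -/p.
have -> : A *m (x + t *: (y - x)) - p = (A *m x - p) + t *: D.
  by rewrite mulmxDr -scalemxAr addrAC.
rewrite sqr_enormDZ -(opprB p) dotmxNl.
have := @l1norm_segment _ _ x y t; rewrite (ltW t0) t1 => /(_ isT); rewrite -/N.
set E := enorm (- _) ^+ 2; set d := dotmx _ _; set F := enorm D ^+ 2.
move=> seg le1; have : (2 * lambda)^-1 * E <=
    (2 * lambda)^-1 * (E + t * (2 * - d) + t ^+ 2 * F) + t * N by lra.
have l20 : 0 < 2 * lambda by lra.
move/(ler_wpM2l (ltW l20)); rewrite mulrDr !mulVKf ?gt_eqF//; lra.
Qed.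

(** The point y + pinvmx A *m (A *m (x - y)) lies in the fibre of x, so its l1
norm bounds that of x from above. *)
Lemma fibre_min_lipschitz (R : realType) m n (A : 'M[R]_(m, n)) :
  exists2 L : R, 0 <= L & forall x y : 'cV[R]_n,
    (forall z, A *m z = A *m x -> l1norm x <= l1norm z) ->
    l1norm x <= l1norm y + L * enorm (A *m (x - y)).
Proof.
exists (\sum_i \sum_j `|pinvmx A i j|) => [|x y xmin].
  by apply: sumr_ge0 => i _; exact: sumr_ge0.
have AP : A *m (pinvmx A *m (A *m (x - y))) = A *m (x - y).
  by rewrite [pinvmx A *m _]mulmxA [LHS]mulmxA [A *m (_ *m _)]mulmxA mulmxKpV.
have := xmin (y + pinvmx A *m (A *m (x - y))).
rewrite mulmxDr AP mulmxBr addrC subrK => /(_ erefl) /le_trans; apply.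
rewrite -mulmxBr (le_trans (l1normD _ _))// lerD2l; exact: l1norm_mulmx_le.
Qed.

Lemma sqr_pair_enorm (R : realType) m (p : R * 'cV[R]_m) :
  pair_enorm p ^+ 2 = p.1 ^+ 2 + enorm p.2 ^+ 2.
Proof. by rewrite sqr_sqrtr// addr_ge0// sqr_ge0. Qed.

(** Adding the variational inequalities of the two solutions, each tested at the
other one, bounds the square of the norm of D = A *m (x - y); the terms that are
linear in D are absorbed by Young's inequality. *)
Lemma lasso_fit_lipschitz (R : realType) m n (A : 'M[R]_(m, n)) :
  exists2 c : R, 0 <= c & forall (p q : R * 'cV[R]_m) (x y : 'cV[R]_n),
    lasso_sol p.1 p.2 A x -> lasso_sol q.1 q.2 A y ->
    enorm (A *m (x - y)) <= c * pair_enorm (p - q).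
Proof.
have [L L0 Lip] := fibre_min_lipschitz A.
exists (2 + 2 * L) => [|[l b] [l' b'] x y /= Sx Sy]; first lra.
have delta0 : 0 <= pair_enorm ((l, b) - (l', b')) by exact: sqrtr_ge0.
rewrite -(@ler_pXn2r _ 2)// ?nnegrE ?enorm_ge0 ?mulr_ge0//; last lra.
rewrite exprMn sqr_pair_enorm /=.
have Nx := Lip x y (fun z => lasso_sol_fibre_min Sx).
have Ny := Lip y x (fun z => lasso_sol_fibre_min Sy).
have := lasso_sol_variational y Sx; have := lasso_sol_variational x Sy.
move: Nx Ny; rewrite -(opprB x y) mulmxN dotmxNr.
set D := A *m (x - y).
have -> : enorm (- D) = enorm D.
  by congr Num.sqrt; apply: eq_bigr => i _; rewrite mxE sqrrN.
move=> Nx Ny Vy Vx.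
have Dxy : dotmx (b - A *m x) D - dotmx (b' - A *m y) D =
    dotmx (b - b') D - enorm D ^+ 2.
  rewrite -dotmxx -!dotmxNl -!dotmxDl; congr dotmx.
  by rewrite /D mulmxBr; apply/colP => i; rewrite !mxE; ring.
have young := dotmx_young (b - b') D.
have dN : `|l1norm y - l1norm x| <= L * enorm D by rewrite ler_norml; lra.
have prod : (l - l') * (l1norm y - l1norm x) <= `|l - l'| * (L * enorm D).
  by rewrite (le_trans (ler_norm _))// normrM ler_wpM2l.
(* Young's inequality with weight 1/4 on the square of the norm of D *)
have amgm := sqr_ge0 (L * `|l - l'| - enorm D / 2).
have D2 : enorm D ^+ 2 <=
    2 * enorm (b - b') ^+ 2 + 4 * (L ^+ 2 * `|l - l'| ^+ 2) by lra.
have b0 := mulr_ge0 L0 (sqr_ge0 (enorm (b - b'))).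
have l0 := mulr_ge0 L0 (sqr_ge0 `|l - l'|).
have b1 := mulr_ge0 (sqr_ge0 L) (sqr_ge0 (enorm (b - b'))).
have b2 := sqr_ge0 (enorm (b - b')); have l2 := sqr_ge0 `|l - l'|.
by rewrite -[(l - l') ^+ 2]real_normK ?num_real//; lra.
Qed.

(** * Error bound for the l1 norm on fibres *)

(** Hoffman's bound for the system A *m y = A *m x, l1norm y <= l1norm x in the
unknown y.  Each equation is written as two inequalities, and the norm bound as
one inequality per sign vector. *)
Lemma l1_fibre_error_bound (R : realType) m n (A : 'M[R]_(m, n)) :
  exists2 kappa : R, 0 <= kappa & forall (x x' : 'cV[R]_n) (e : R),
    (forall i, `|(A *m (x' - x)) i 0| <= e) -> 0 <= e -> l1norm x' <= l1norm x + e ->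
    exists y, [/\ A *m y = A *m x, l1norm y <= l1norm x
                & enorm (x' - y) <= kappa * e].
Proof.
pose I : finType := (('I_m * bool) + {ffun 'I_n -> bool})%type.
pose B (s : I) j : R := match s with
  | inl (i, sg) => (-1) ^+ sg * A i j | inr f => (-1) ^+ f j end.
have [kappa kappa0 kappaP] := hoffman B.
have Binl i sg (x : 'I_n -> R) : \sum_j B (inl (i, sg)) j * x j =
    (-1) ^+ sg * (A *m \col_j x j) i 0.
  by rewrite mxE mulr_sumr; apply: eq_bigr => j _; rewrite mxE mulrA.
have Binr f (x : 'cV[R]_n) : \sum_j B (inr f) j * x j 0 <= l1norm x.
  apply: ler_sum => j _; rewrite (le_trans (ler_norm _))// normrM normrX normrN1.
  by rewrite expr1n mul1r.
have colE (x : 'cV[R]_n) : \col_j x j 0 = x by apply/colP => j; rewrite mxE.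
exists (n%:R * kappa) => [|x x' e Ae e0 l1e]; first by rewrite mulr_ge0.
pose d (s : I) := match s with
  | inl (i, sg) => (-1) ^+ sg * (A *m x) i 0 | inr f => l1norm x end.
have [| |y yP yx'] := kappaP d (fun j => x j 0) (fun j => x' j 0) e e0.
- by case=> [[i sg]|f] /=; [rewrite Binl colE|exact: Binr].
- case=> [[i sg]|f] /=; last exact: le_trans (Binr _ _) l1e.
  rewrite Binl colE -lerBlDl -mulrBr; have := Ae i; rewrite mulmxBr !mxE.
  by rewrite ler_norml => /andP[]; case: sg; rewrite ?expr1 ?expr0; lra.
exists (\col_j y j); split.
- apply/colP => i; apply/eqP; rewrite eq_le.
  have := yP (inl (i, false)); have := yP (inl (i, true)).
  by rewrite !Binl /d/= expr1 expr0 !mulN1r !mul1r lerN2 => -> ->.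
- have := yP (inr [ffun j => y j < 0]); rewrite /d; apply: le_trans.
  rewrite le_eqVlt; apply/orP; left; apply/eqP/eq_bigr => j _.
  by rewrite mxE /= ffunE normrEsign ?num_real.
- rewrite (le_trans (enorm_le_l1norm _))// -mulrA mulr_natl.
  rewrite -[n in leRHS]card_ord -sumr_const.
  by apply: ler_sum => j _; rewrite !mxE distrC.
Qed.

Lemma in_scaled_ball (R : realType) n (v : 'cV[R]_n) (c : R) : enorm v <= c ->
  exists2 u, eball u & c *: u = v.
Proof.
move=> vc; have c0 : 0 <= c := le_trans (enorm_ge0 _) vc.
have enormZ (a : R) : 0 <= a -> enorm (a *: v) = a * enorm v.
  move=> a0; apply/eqP; rewrite -(@eqrXn2 _ 2)// ?enorm_ge0 ?mulr_ge0 ?enorm_ge0//.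
  rewrite exprMn !sqr_enorm_sum mulr_sumr; apply/eqP/eq_bigr => i _.
  by rewrite mxE exprMn.
(* c = 0 is harmless: the hypothesis then forces v = 0 *)
exists (c^-1 *: v).
  rewrite /eball/= enormZ ?invr_ge0//.
  have [->|cn0] := eqVneq c 0; first by rewrite invr0 mul0r.
  by rewrite mulrC ler_pdivrMr ?mul1r// lt_neqAle eq_sym cn0.
have [c0'|cn0] := eqVneq c 0; last by rewrite scalerA divff// scale1r.
have /sqr_enorm_le0 -> : enorm v ^+ 2 <= 0; last by rewrite !scaler0.
have -> : enorm v = 0 by apply/eqP; rewrite eq_le enorm_ge0 -c0' vc.
by rewrite expr0n.
Qed.

(** * Lipschitz continuity of the solution multifunction *)

Unset Implicit Arguments.

Theorem theorem3p1 (R : realType) (m n : nat) (A : 'M[R]_(m, n)) :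
  mf_dom (fun p : R * 'cV[R]_m => lasso_sol p.1 p.2 A) = [set p | 0 <= p.1] /\
  mf_lipschitz_on (@pair_enorm R m)
    (fun p : R * 'cV[R]_m => lasso_sol p.1 p.2 A) [set p | 0 <= p.1].
Proof.
split.
  apply/seteqP; split=> p /=; last exact: lasso_sol_nonempty.
  move=> [x]; rewrite /lasso_sol; case: ifP => [/ltW//|_].
  by case: ifP => [/eqP ->|].
split=> [p p0|].
  by split; [exact: lasso_sol_nonempty|exact: lasso_sol_closed].
have [c c0 fit] := lasso_fit_lipschitz A.
have [L L0 Lip] := fibre_min_lipschitz A.
have [k k0 bound] := l1_fibre_error_bound A.
have K0 : 0 <= (1 + L) * c by rewrite mulr_ge0// addr_ge0.
exists (k * ((1 + L) * c)) => [|p q p0 q0 x' Sx']; first exact: mulr_ge0.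
(* any solution x at p serves to describe the whole solution set at p *)
have [x Sx] := lasso_sol_nonempty A p.2 p0.
have delta0 : 0 <= pair_enorm (q - p) by exact: sqrtr_ge0.
have Dfit := fit _ _ _ _ Sx' Sx.
have D0 := enorm_ge0 (A *m (x' - x)).
have LD := ler_wpM2l L0 Dfit.
have LD0 := mulr_ge0 L0 D0.
have [i| | |y [Ay y1 yx']] := bound x x' ((1 + L) * c * pair_enorm (q - p)).
- by rewrite (le_trans (coord_le_enorm _ i))//; lra.
- exact: mulr_ge0.
- by have := Lip x' x (fun z => lasso_sol_fibre_min Sx'); lra.
exists y; first exact: lasso_sol_fibre Sx Ay y1.
rewrite mulrA in yx'; have [u u1 uE] := in_scaled_ball yx'.
by exists u => //; rewrite uE addrC subrK.
Qed.
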